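(* Let $p\ge 1$ and $n\ge 1$ be integers. Consider $p$ random turns walkers on the one-dimensional lattice $\mathbb{Z}$, initially equally spaced one unit apart (walker $j$ at site $j$, $j=1,\dots,p$), and returning to their initial positions after $2n$ steps. Suppose the walkers make their steps in the sequence $L^nR^n$, i.e. each of the first $n$ steps is a step to the left and each of the last $n$ steps is a step to the right. Then the total number of distinct configurations equals the number of permutations of $\{1,\dots,n\}$ such that the length of the maximum increasing subsequence is less than or equal to $p$.
   Context: Random turns walkers: $p$ labelled walkers occupy distinct sites of $\mathbb{Z}$. At each time step $t=1,2,\dots,2n$ exactly one walker moves, by exactly one lattice site, either to the left (a step $L$, position decreases by $1$) or to the right (a step $R$, position increases by $1$), while all other walkers stay where they are; at no time may two walkers occupy the same lattice site. A configuration is a full history of such moves: a sequence $x(0),x(1),\dots,x(2n)$ with $x(t)=(x_1(t),\dots,x_p(t))\in\mathbb{Z}^p$ having pairwise distinct entries, where $x(t)$ and $x(t-1)$ differ in exactly one coordinate and by exactly $\pm1$ in that coordinate, and $x(0)=x(2n)=(1,2,\dots,p)$. Two configurations are distinct if they differ as sequences. For this counting problem left and right moves are weighted equally, so it is simply the number of configurations that is counted. A configuration follows a given word of length $2n$ in the letters $L,R$ if, for each $t$, the walker moving at time $t$ moves in the direction given by the $t$-th letter; $L^nR^n$ denotes the word consisting of $n$ letters $L$ followed by $n$ letters $R$. An increasing subsequence of a permutation $\pi$ of $\{1,\dots,n\}$ is $\pi(i_1)<\pi(i_2)<\dots<\pi(i_k)$ with $i_1<i_2<\dots<i_k$; its length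 is $k$. *)

(* Defs.v *)
(* MathComp, with the cardinality of sets from MathComp-Analysis' classical layer. *)
From mathcomp Require Import all_boot all_fingroup all_order all_algebra.
From mathcomp Require Import classical_sets cardinality.
Set Implicit Arguments.
Unset Strict Implicit.
Unset Printing Implicit Defensive.
Import GRing.Theory.
Local Open Scope ring_scope.

Inductive letter := L | R.

Definition displacement (a : letter) : int := if a is L then - 1 else 1.

Section Walkers.
Variable p : nat.

(* The site of each walker; walker j of {1..p} has index j - 1 : 'I_p. *)
Definition positions := {ffun 'I_p -> int}.

Definition initial_positions : positions := [ffun j : 'I_p => j.+1%:Z].

(* The positions at times 0, 1, ..., m. *)
Definition history m := {ffun 'I_m.+1 -> positions}.

Section History.
Variables (m : nat) (x : history m).

(* For t : 'I_m, the move from [before t] to [after t] is the step made at time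
   t.+1, that is from x(t) to x(t.+1), governed by the letter of index t. *)
Definition before (t : 'I_m) : positions := x (widen_ord (leqnSn m) t).
Definition after (t : 'I_m) : positions := x (lift ord0 t).

Definition is_move (y z : positions) : Prop :=
  exists j : 'I_p,
    (z j = y j - 1 \/ z j = y j + 1) /\ (forall k, k != j -> z k = y k).

Definition is_configuration : Prop :=
  [/\ x ord0 = initial_positions,
      x ord_max = initial_positions,
      forall t, injective (x t) &
      forall t, is_move (before t) (after t)].

Definition follows (w : m.-tuple letter) : Prop :=
  forall (t : 'I_m) (j : 'I_p), after t j != before t j ->
    after t j = before t j + displacement (tnth w t).

End History.

Definition configurations_following m (w : m.-tuple letter) : set (history m) :=
  [set x | is_configuration x /\ follows x w]%classic.

End Walkers.

Arguments configurations_following p {m} w.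

Definition LnRn (n : nat) : (n + n).-tuple letter := [tuple of nseq n L ++ nseq n R].

(* An increasing subsequence s(i_1) < ... < s(i_k), with i_1 < ... < i_k, is
   given by the set A = {i_1, ..., i_k} of its indices. *)
Definition increasing_on n (s : 'S_n) (A : {set 'I_n}) : bool :=
  [forall i in A, forall j in A, (i < j)%N ==> (s i < s j)%N].

Definition max_increasing_length n (s : 'S_n) : nat :=
  \max_(A : {set 'I_n} | increasing_on s A) #|A|.

(* Main.v *)
Require Import Defs.
From mathcomp Require Import all_boot all_fingroup.
From mathcomp Require Import classical_sets cardinality.
From mathcomp Require Import zify ssralg ssrint.

(** The configurations are counted by the Robinson-Schensted correspondence,
    built here from growth diagrams.

    While only L-steps are made, the displacements of the p walkers form a
    weakly decreasing sequence, that is a partition with at most p parts, and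
    each step adds one cell to it.  A configuration following L^n R^n is thus a
    pair of chains of partitions growing cell by cell from the empty one to a
    common partition of n: the first n steps, and the last n steps read
    backwards.  We view the displacements as the column lengths of a Young
    diagram; its rows then have length at most p.

    A growth diagram puts a partition (given by its row lengths, as a function
    from nat to nat) at each vertex of a grid and a number at each cell, the
    four corners and the number of a cell being tied by [local_rule].  This rule
    determines the corner far from the origin from the number and the three
    other corners, and, conversely, the number and the near corner from the
    three others; both ways it keeps neighbouring partitions interlaced.  Hence
    a matrix of numbers and the pair of chains read along the two far sides of
    the grid determine each other ([grow_inj], [grow_surj]).

    Two consequences of the rule link this bijection to the problem.  Summed
    over all rows, it says that the line sums of the matrix are the successive
    increments of the sizes along the far sides ([grow_row_sum],
    [grow_col_sum]): permutation matrices correspond to pairs of chains growing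
    by one cell at a time.  Restricted to the first row, it is the recursion for
    the longest increasing subsequence inside a rectangle
    ([max_increasing_length_grow]): the first row of the final partition has
    length at most p exactly when the permutation has no increasing subsequence
    of more than p terms. *)

Set Implicit Arguments.
Unset Strict Implicit.
Unset Printing Implicit Defensive.

(** * Interlacing and the local rule *)

(** Between partitions: the skew shape [g / f] is a horizontal strip. *)
Definition interlace (f g : nat -> nat) :=
  forall k, (f k <= g k) && (g k.+1 <= f k).

(** Here [r], [u], [v], [l] are the near, the two lateral and the far corner of
    a cell.  This is Fomin's rule in its piecewise linear form: equating the
    two sides of [l k.+1 + r k = ...] avoids a case distinction on which of the
    four partitions coincide, and is solvable for [l] as well as for [r]. *)
Definition local_rule (r u v : nat -> nat) m (l : nat -> nat) :=
  l 0 = maxn (u 0) (v 0) + m /\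
  forall k, l k.+1 + r k = maxn (u k.+1) (v k.+1) + minn (u k) (v k).

Definition grow_cell (r u v : nat -> nat) m : nat -> nat := fun k =>
  if k is k'.+1 then maxn (u k) (v k) + minn (u k') (v k') - r k'
  else maxn (u 0) (v 0) + m.

Definition shrink_cell (l u v : nat -> nat) : nat -> nat := fun k =>
  maxn (u k.+1) (v k.+1) + minn (u k) (v k) - l k.+1.

Lemma grow_cellP r u v m : interlace r u -> interlace r v ->
  local_rule r u v m (grow_cell r u v m).
Proof. by move=> ru rv; split=> // k; move: (ru k) (rv k) => /=; lia. Qed.

Lemma shrink_cellP l u v : interlace u l -> interlace v l ->
  local_rule (shrink_cell l u v) u v (l 0 - maxn (u 0) (v 0)) l.
Proof.
move=> ul vl; split=> [|k]; first by move: (ul 0) (vl 0); lia.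
by rewrite /shrink_cell; move: (ul k) (vl k) (ul k.+1) (vl k.+1); lia.
Qed.

(** Interlacing at the near corner gives [maxn (u k.+1) (v k.+1) <= r k] and
    [r k <= minn (u k) (v k)], so that [l k.+1] lies between the maximum at
    [k.+1] and the minimum at [k]. *)
Lemma local_rule_interlace r u v m l : local_rule r u v m l ->
  interlace r u -> interlace r v -> interlace u l /\ interlace v l.
Proof.
move=> [l0 lS] ru rv; split=> -[|k].
- by move: (ru 0) (rv 0) (lS 0); lia.
- by move: (ru k) (rv k) (lS k) (ru k.+1) (rv k.+1) (lS k.+1); lia.
- by move: (ru 0) (rv 0) (lS 0); lia.
- by move: (ru k) (rv k) (lS k) (ru k.+1) (rv k.+1) (lS k.+1); lia.
Qed.

Lemma local_rule_interlace_rev r u v m l : local_rule r u v m l ->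
  interlace u l -> interlace v l -> interlace r u /\ interlace r v.
Proof.
move=> [_ lS] ul vl; split=> k;
  by move: (ul k) (vl k) (lS k) (ul k.+1) (vl k.+1); lia.
Qed.

Lemma local_rule_sym r u v m l :
  local_rule r u v m l -> local_rule r v u m l.
Proof.
by move=> [l0 lS]; split=> [|k]; rewrite ?l0 ?lS maxnC 1?[minn (u k) _]minnC.
Qed.

Lemma interlace_antitone f g : interlace f g ->
  (forall k, f k.+1 <= f k) /\ (forall k, g k.+1 <= g k).
Proof. by move=> fg; split=> k; move: (fg k) (fg k.+1); lia. Qed.

(** * Growth diagrams of a matrix *)

Section Grid.
Variables (T : Type) (cell : nat -> nat -> T -> T -> T -> T).

Fixpoint grid_row (left : T) (prev : nat -> T) i j : T :=
  if j is j'.+1 then cell i j' (prev j') (grid_row left prev i j') (prev j)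
  else left.

Fixpoint grid (top left : nat -> T) i : nat -> T :=
  if i is i'.+1 then grid_row (left i) (grid top left i') i' else top.

Lemma gridS top left i j : grid top left i.+1 j.+1 =
  cell i j (grid top left i j) (grid top left i.+1 j) (grid top left i j.+1).
Proof. by []. Qed.

End Grid.

(** Used with interlacing to go away from the origin, and with reversed
    interlacing to come back from the far sides. *)
Lemma grid_propagate T (e : T -> T -> Prop) (G : nat -> nat -> T) :
    (forall j, e (G 0 j) (G 0 j.+1)) -> (forall i, e (G i 0) (G i.+1 0)) ->
    (forall i j, e (G i j) (G i.+1 j) -> e (G i j) (G i j.+1) ->
       e (G i.+1 j) (G i.+1 j.+1) /\ e (G i j.+1) (G i.+1 j.+1)) ->
  forall i j, e (G i j) (G i.+1 j) /\ e (G i j) (G i j.+1).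
Proof.
move=> e0r e0c eS.
have step i : (forall j, e (G i j) (G i j.+1)) ->
    forall j, e (G i j) (G i.+1 j).
  move=> er; elim=> [|j IHj]; first exact: e0c.
  by have [] := eS i j IHj (er j).
have erow i : forall j, e (G i j) (G i j.+1).
  elim: i => // i IHi j.
  by have [] := eS i j (step i IHi j) (IHi j).
by move=> i j; split; [apply: step|].
Qed.

Definition grow (M : nat -> nat -> nat) : nat -> nat -> nat -> nat :=
  grid (fun i j r u v => grow_cell r u v (M i j)) (fun _ _ => 0) (fun _ _ => 0).

Lemma growi0 M i : grow M i 0 =1 fun=> 0. Proof. by case: i. Qed.

Lemma grow_interlace M i j :
  interlace (grow M i j) (grow M i.+1 j) /\
  interlace (grow M i j) (grow M i j.+1).
Proof.
move: i j; apply: (@grid_propagate _ interlace) => [j k|i k|i j ru rv] //.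
  by rewrite !growi0.
have [vl ul] := local_rule_interlace (grow_cellP (M i j) ru rv) ru rv.
by rewrite {2}/grow {3}/grow gridS.
Qed.

Lemma growP M i j :
  local_rule (grow M i j) (grow M i.+1 j) (grow M i j.+1) (M i j)
             (grow M i.+1 j.+1).
Proof. by have [ru rv] := grow_interlace M i j; apply: grow_cellP. Qed.

Lemma grow_antitone M i j k : grow M i j k.+1 <= grow M i j k.
Proof. by have [/interlace_antitone[]] := grow_interlace M i j. Qed.

Lemma grow_leq M i i' j j' k :
  i <= i' -> j <= j' -> grow M i j k <= grow M i' j' k.
Proof.
move=> ii' jj'; apply: (@leq_trans (grow M i' j k)).
  rewrite -(subnK ii'); elim: (i' - i) => //= m IHm; apply: leq_trans IHm _.
  by have [/(_ k)/andP[]] := grow_interlace M (m + i) j.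
rewrite -(subnK jj'); elim: (j' - j) => //= m IHm; apply: leq_trans IHm _.
by have [_ /(_ k)/andP[]] := grow_interlace M i' (m + j).
Qed.

Lemma grow_leq_row0 M i j k : grow M i j k <= grow M i j 0.
Proof. by elim: k => // k; apply: leq_trans; apply: grow_antitone. Qed.

(** The rule determines the far corner of each cell, so that a diagram is
    recognized as the one of [M] by its zero sides and its cells. *)
Lemma grow_unique M n G :
    (forall j, j <= n -> G 0 j =1 fun=> 0) ->
    (forall i, i <= n -> G i 0 =1 fun=> 0) ->
    (forall i j, i < n -> j < n ->
       local_rule (G i j) (G i.+1 j) (G i j.+1) (M i j) (G i.+1 j.+1)) ->
  forall i j, i <= n -> j <= n -> G i j =1 grow M i j.
Proof.
move=> G0j Gi0 GS; elim=> [|i IHi] j; first by move=> _ /G0j Gj k; rewrite Gj.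
move=> lin; elim: j => [_ k|j IHj ljn]; first by rewrite Gi0 // growi0.
have er := IHi j (ltnW lin) (ltnW ljn); have ev := IHi j.+1 (ltnW lin) ljn.
have eu := IHj (ltnW ljn).
have [G0 GSk] := GS i j lin ljn; have [g0 gS] := growP M i j.
case=> [|k]; first by rewrite G0 g0 eu ev.
have := GSk k; have := gS k; rewrite !eu !ev er.
by move=> <- /addIn.
Qed.

Lemma grow_transpose M i j : grow (fun a b => M b a) i j =1 grow M j i.
Proof.
move=> k; symmetry.
pose n := maxn i j.
apply: (@grow_unique (fun a b => M b a) n (fun a b => grow M b a)) => //.
- by move=> b _; apply: growi0.
- by move=> a b _ _; apply/local_rule_sym/growP.
- exact: leq_maxl.
- exact: leq_maxr.
Qed.

(** The rule determines the near corner and the number of each cell from the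
    three other corners, hence the whole diagram from its two far sides. *)
Lemma grow_inj n M M' :
    (forall j, j <= n -> grow M n j =1 grow M' n j) ->
    (forall i, i <= n -> grow M i n =1 grow M' i n) ->
  forall i j, i < n -> j < n -> M i j = M' i j.
Proof.
move=> bot right.
have cell i j : grow M i.+1 j =1 grow M' i.+1 j ->
    grow M i j.+1 =1 grow M' i j.+1 -> grow M i.+1 j.+1 =1 grow M' i.+1 j.+1 ->
    grow M i j =1 grow M' i j /\ M i j = M' i j.
  move=> eu ev el.
  have [g0 gS] := growP M i j; have [g0' gS'] := growP M' i j.
  split=> [k|].
    by have := gS k; have := gS' k; rewrite !eu !ev !el => <- /addnI.
  by move: g0 g0'; rewrite !eu !ev !el => ->; move/addnI.
have eqG a b : a <= n -> b <= n ->
    grow M (n - a) (n - b) =1 grow M' (n - a) (n - b).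
  elim: a b => [|a IHa] b; first by rewrite subn0 => _ _; apply: bot; lia.
  move=> lan; elim: b => [_|b IHb lbn].
    by rewrite subn0; apply: right; lia.
  have Ea : n - a = (n - a.+1).+1 by lia.
  have Eb : n - b = (n - b.+1).+1 by lia.
  apply: (cell _ _ _ _ _).1; rewrite -?Ea -?Eb.
  + by apply: IHa; lia.
  + by apply: IHb; lia.
  + by apply: IHa; lia.
have eqG' i j : i <= n -> j <= n -> grow M i j =1 grow M' i j.
  by move=> lin ljn; rewrite -(subKn lin) -(subKn ljn); apply: eqG; lia.
by move=> i j lin ljn; apply: (cell _ _ _ _ _).2; apply: eqG'; lia.
Qed.

(** The diagram is rebuilt backwards from its far sides.  The corner common to a
    far side and a near side is empty, and the partitions decrease towards the
    origin, so the near sides are empty, as they must be for a diagram of the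
    form [grow M]. *)
Lemma grow_surj n (P Q : nat -> nat -> nat) :
    P 0 =1 (fun=> 0) -> Q 0 =1 (fun=> 0) -> P n = Q n ->
    (forall j, j < n -> interlace (P j) (P j.+1)) ->
    (forall i, i < n -> interlace (Q i) (Q i.+1)) ->
  exists M, (forall j, j <= n -> grow M n j =1 P j) /\
            (forall i, i <= n -> grow M i n =1 Q i).
Proof.
move=> P0 Q0 PQ Pint Qint.
(* [K a b] sits at the vertex (n - a, n - b). *)
pose K := grid (fun _ _ => shrink_cell)
               (fun b => P (n - b)) (fun a => Q (n - a)).
have K0b b : K 0 b = P (n - b) by [].
have Ka0 a : K a 0 = Q (n - a) by case: a => //; rewrite K0b subn0.
have back (S : nat -> nat -> nat) a : S 0 =1 (fun=> 0) ->
    (forall i, i < n -> interlace (S i) (S i.+1)) ->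
    interlace (S (n - a.+1)) (S (n - a)).
  move=> S0 Sint; have [lan|lna] := ltnP a n.
    by have -> : n - a = (n - a.+1).+1; [lia | apply: Sint; lia].
  have -> : n - a.+1 = 0 by lia.
  by have -> : n - a = 0; [lia | move=> k; rewrite !S0].
have Kint : forall a b,
    interlace (K a.+1 b) (K a b) /\ interlace (K a b.+1) (K a b).
  apply: (@grid_propagate _ (fun l u => interlace u l)).
  - by move=> b; rewrite !K0b; apply: back.
  - by move=> a; rewrite !Ka0; apply: back.
  - move=> a b ul vl.
    exact: (local_rule_interlace_rev (shrink_cellP ul vl) ul vl).
have Krule a b : local_rule (K a.+1 b.+1) (K a.+1 b) (K a b.+1)
    (K a b 0 - maxn (K a.+1 b 0) (K a b.+1 0)) (K a b).
  by have [ul vl] := Kint a b; apply: shrink_cellP.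
have Kle a b k : K a.+1 b k <= K a b k /\ K a b.+1 k <= K a b k.
  by have [/(_ k)/andP[? _] /(_ k)/andP[]] := Kint a b.
have Kn0 b k : K n b k = 0.
  elim: b => [|b IHb]; first by rewrite Ka0 subnn Q0.
  by have := (Kle n b k).2; rewrite IHb leqn0 => /eqP.
have K0n a k : K a n k = 0.
  elim: a => [|a IHa]; first by rewrite K0b subnn P0.
  by have := (Kle a n k).1; rewrite IHa leqn0 => /eqP.
pose G i j := K (n - i) (n - j).
pose M i j := G i.+1 j.+1 0 - maxn (G i.+1 j 0) (G i j.+1 0).
have GM : forall i j, i <= n -> j <= n -> G i j =1 grow M i j.
  apply: grow_unique => [j _ k|i _ k|i j lin ljn].
  - by rewrite /G subn0 Kn0.
  - by rewrite /G subn0 K0n.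
  - have := Krule (n - i.+1) (n - j.+1).
    rewrite /M /G; have -> : (n - i.+1).+1 = n - i by lia.
    have -> : (n - j.+1).+1 = n - j by lia.
    by rewrite maxnC => /local_rule_sym.
exists M; split=> [j ljn k|i lin k]; rewrite -GM // /G subnn.
  by rewrite K0b subKn.
by rewrite Ka0 subKn.
Qed.

Lemma grow_support M i j k : i <= k -> grow M i j k = 0.
Proof.
elim: i j k => [|i IHi] j [|k] //= lik.
elim: j => [|j IHj]; first by rewrite growi0.
have [_ /(_ k)] := growP M i j.
by rewrite IHj !(IHi j.+1) ?(IHi j) //; lia.
Qed.

(** The maximum at row [k] comes with the minimum at the same row in the next
    equation of the rule, and their sum is [u k + v k]. *)
Lemma local_rule_size n r u v m l : local_rule r u v m l ->
    u n = 0 -> v n = 0 -> l n = 0 ->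
  \sum_(k < n) l k + \sum_(k < n) r k =
    \sum_(k < n) u k + \sum_(k < n) v k + m.
Proof.
move=> [l0 lS] un vn ln.
have partial : \sum_(k < n.+1) l k + \sum_(k < n) r k =
    \sum_(k < n) u k + \sum_(k < n) v k + maxn (u n) (v n) + m.
  elim: n {un vn ln} => [|n IHn].
    by rewrite big_ord_recr !big_ord0 /= l0 !addn0.
  rewrite big_ord_recr /=; move: IHn (lS n).
  rewrite [\sum_(k < n.+1) r k]big_ord_recr [\sum_(k < n.+1) u k]big_ord_recr.
  by rewrite [\sum_(k < n.+1) v k]big_ord_recr /=; lia.
by move: partial; rewrite big_ord_recr /= un vn ln !addn0.
Qed.

Lemma grow_row_sum M n i : i < n ->
  \sum_(k < n) grow M i.+1 n k =
    \sum_(k < n) grow M i n k + \sum_(j < n) M i j.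
Proof.
move=> lin.
suff all_j j : \sum_(k < n) grow M i.+1 j k =
    \sum_(k < n) grow M i j k + \sum_(j' < j) M i j' by apply: all_j.
elim: j => [|j IHj].
  by rewrite big_ord0 addn0; apply: eq_bigr => k _; rewrite !growi0.
have := local_rule_size (growP M i j) (grow_support _ _ _) (grow_support _ _ _)
  (grow_support _ _ _).
move=> /(_ n lin (ltnW lin) lin); rewrite IHj big_ord_recr /=; lia.
Qed.

Lemma grow_col_sum M n j : j < n ->
  \sum_(k < n) grow M n j.+1 k =
    \sum_(k < n) grow M n j k + \sum_(i < n) M i j.
Proof.
move=> ljn; have := grow_row_sum (fun a b => M b a) ljn.
rewrite (eq_bigr (fun k : 'I_n => grow M n j.+1 k)) => [->|k _]; last first.
  exact: grow_transpose.
by congr (_ + _); apply: eq_bigr => k _; rewrite grow_transpose.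
Qed.

(** * Permutation matrices and increasing subsequences *)

Section Permutation.
Variables (n : nat) (s : 'S_n).

Definition perm_matrix (i j : nat) : nat :=
  [exists a : 'I_n, (a == i :> nat) && (s a == j :> nat)].

Lemma perm_matrixE (a b : 'I_n) : perm_matrix a b = (s a == b).
Proof.
congr nat_of_bool; apply/existsP/eqP.
  by move=> [c /andP[/eqP/val_inj<- /eqP/val_inj]].
by move=> <-; exists a; rewrite !eqxx.
Qed.

Lemma perm_matrix_row_sum (a : 'I_n) : \sum_(j < n) perm_matrix a j = 1.
Proof.
under eq_bigr do rewrite perm_matrixE.
rewrite (bigD1 (s a)) //= eqxx big1 // => b /negPf.
by rewrite eq_sym => ->.
Qed.

Lemma perm_matrix_col_sum (b : 'I_n) : \sum_(i < n) perm_matrix i b = 1.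
Proof.
under eq_bigr do rewrite perm_matrixE.
rewrite (bigD1 (s^-1 b)%g) //= permKV eqxx big1 // => a aNb.
by case: eqP => // E; rewrite -E permK eqxx in aNb.
Qed.

Lemma increasing_onP (A : {set 'I_n}) :
  reflect {in A &, forall a b : 'I_n, a < b -> s a < s b} (increasing_on s A).
Proof.
apply: (iffP forall_inP) => [inc a b aA bA | inc a aA].
  by move/forall_inP: (inc a aA) => /(_ b bA)/implyP.
by apply/forall_inP => b bA; apply/implyP; apply: inc.
Qed.

(** Let [a0] be the last index of the box.  Without [a0], the set fits in the
    box with one index less.  This settles the case where the new cell is the
    point of [a0], since that cell then counts for one.  Otherwise a set
    containing [a0] has all its values below [j], since that of [a0] is the
    largest. *)
Lemma leq_increasing_grow i j (A : {set 'I_n}) :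
    i <= n -> j <= n -> increasing_on s A ->
    (forall a, a \in A -> (a < i) && (s a < j)) ->
  #|A| <= grow perm_matrix i j 0.
Proof.
elim: i j A => [|i IHi] j A.
  move=> _ _ _ Abox; rewrite leqNgt card_gt0.
  by apply/negP => /set0Pn[a /Abox].
move=> lin; elim: j A => [|j IHj] A ljn incA Abox.
  by rewrite leqNgt card_gt0; apply/negP => /set0Pn[a /Abox]; rewrite andbF.
have [-> _] := growP perm_matrix i j.
pose a0 := Ordinal lin; pose b0 := Ordinal ljn.
have -> : perm_matrix i j = (s a0 == b0) by rewrite -perm_matrixE.
have subinc (B : {set 'I_n}) : B \subset A -> increasing_on s B.
  move=> /fintype.subsetP BA; apply/increasing_onP => a b /BA aA /BA bA.
  exact: (increasing_onP _ incA).
have [sa0|sa0] := eqVneq (s a0) b0.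
  have boxD : #|A :\ a0| <= grow perm_matrix i j.+1 0.
    apply: (IHi j.+1 (A :\ a0)) => //; [lia | exact: subinc (subD1set _ _) |].
    move=> a; rewrite !inE => /andP[/eqP aa0 /Abox/andP[ai ->]].
    rewrite andbT ltn_neqAle -ltnS ai andbT.
    by apply/eqP => E; case: aa0; apply: val_inj.
  move: boxD; rewrite (cardsD1 a0 A).
  move: (#|A :\ a0|) (grow _ i j.+1 0) (grow _ i.+1 j 0) => x y z.
  by case: (a0 \in A) => /=; lia.
have [a0A|a0A] := boolP (a0 \in A); last first.
  have : #|A| <= grow perm_matrix i j.+1 0; last by lia.
  apply: IHi => //; first by lia.
  move=> a aA; have /andP[ai ->] := Abox _ aA.
  rewrite andbT ltn_neqAle -ltnS ai andbT; apply/eqP => E.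
  by move: a0A; rewrite (_ : a0 = a) ?aA //; apply: val_inj.
have : #|A| <= grow perm_matrix i.+1 j 0; last by lia.
apply: IHj => //; first by lia.
move=> a aA; have /andP[ai saj] := Abox _ aA; rewrite ai /=.
have /andP[_ sa0j] := Abox _ a0A.
have {}sa0j : s a0 < j.
  by rewrite ltn_neqAle -ltnS sa0j andbT.
have [->//|aNa0] := eqVneq a a0.
apply: ltn_trans sa0j; apply: (increasing_onP _ incA) => //.
by rewrite /= ltn_neqAle -ltnS ai andbT.
Qed.

(** If the new cell is a point of the permutation, its row and its column have
    no other point, so an optimal set for either lateral box lies strictly below
    and to the left of it, and can be extended by it. *)
Lemma exists_increasing_grow i j : i <= n -> j <= n ->
  exists2 A : {set 'I_n}, increasing_on s A /\
    (forall a, a \in A -> (a < i) && (s a < j)) & #|A| = grow perm_matrix i j 0.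
Proof.
have empty i' j' : grow perm_matrix i' j' 0 = 0 ->
    exists2 A : {set 'I_n}, increasing_on s A /\
      (forall a, a \in A -> (a < i') && (s a < j')) &
      #|A| = grow perm_matrix i' j' 0.
  move=> ->; exists finset.set0; rewrite ?cards0 //.
  by split=> [|a]; rewrite ?inE //; apply/increasing_onP => a b; rewrite inE.
elim: i j => [|i IHi] j lin; first by move=> _; apply: empty.
elim: j => [|j IHj] ljn; first by apply: empty; rewrite growi0.
have [-> _] := growP perm_matrix i j.
have [A [incA boxA] cardA] := IHj (ltnW ljn).
have [B [incB boxB] cardB] := IHi j.+1 (ltnW lin) ljn.
pose C := if #|A| <= #|B| then B else A.
have [incC boxC] : increasing_on s C /\
    (forall a, a \in C -> (a < i.+1) && (s a < j.+1)).
  by rewrite /C; case: ifP => _; split=> // a; [move/boxB|move/boxA]; lia.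
have cardC :
    #|C| = maxn (grow perm_matrix i.+1 j 0) (grow perm_matrix i j.+1 0).
  by rewrite -cardA -cardB /C; case: leqP; lia.
pose a0 := Ordinal lin; pose b0 := Ordinal ljn.
have -> : perm_matrix i j = (s a0 == b0) by rewrite -perm_matrixE.
have [sa0|sa0] := eqVneq (s a0) b0; last first.
  by exists C => //=; rewrite addn0.
have val_sa0 : s a0 = j :> nat by rewrite sa0.
have {}boxC a : a \in C -> (a < i) && (s a < j).
  rewrite /C; case: ifP => _ aC.
    have /andP[ai saj] := boxB _ aC; rewrite ai /=.
    rewrite ltn_neqAle -ltnS saj andbT; apply/eqP => E.
    have Ea : a = a0.
      by apply: (@perm_inj _ s); apply: val_inj; rewrite /= E val_sa0.
    by move: ai; rewrite Ea /= ltnn.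
  have /andP[ai saj] := boxA _ aC; rewrite saj andbT.
  rewrite ltn_neqAle -ltnS ai andbT; apply/eqP => E.
  have Ea : a = a0 by apply: val_inj.
  by move: saj; rewrite Ea val_sa0 ltnn.
exists (a0 |: C); last first.
  rewrite cardsU1 cardC; have -> : a0 \notin C; last by rewrite addnC.
  by apply/negP => /boxC; rewrite /= ltnn.
split=> [|a]; last first.
  by rewrite !inE => /orP[/eqP->|/boxC]; rewrite ?val_sa0 /=; lia.
apply/increasing_onP => a b; rewrite !inE.
move=> /orP[/eqP->|aC] /orP[/eqP->|bC] ab; first by rewrite ltnn in ab.
- by have /andP[bi _] := boxC _ bC; move: ab; rewrite /=; lia.
- by have /andP[_ saj] := boxC _ aC; rewrite val_sa0.
- exact: (increasing_onP _ incC) ab.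
Qed.

Lemma max_increasing_length_grow :
  max_increasing_length s = grow perm_matrix n n 0.
Proof.
apply/eqP; rewrite eqn_leq; apply/andP; split.
  apply/bigmax_leqP => A incA; apply: leq_increasing_grow => // a _.
  by rewrite !ltn_ord.
have [A [incA _] <-] := exists_increasing_grow (leqnn n) (leqnn n).
exact: leq_bigmax_cond.
Qed.

End Permutation.

Lemma perm_matrix_surj n (M : nat -> nat -> nat) :
    (forall i : 'I_n, \sum_(j < n) M i j = 1) ->
    (forall j : 'I_n, \sum_(i < n) M i j = 1) ->
  exists s : 'S_n, forall i j : 'I_n, M i j = perm_matrix s i j.
Proof.
move=> row col.
have /fin_all_exists[f fP] (i : 'I_n) :
    exists j : 'I_n, forall k : 'I_n, M i k = (j == k).
  have /eqP/sum_nat_eq1[j [_ Mij Mi0]] := row i.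
  exists j => k; have [<-//|jk] := eqVneq j k.
  by apply: Mi0; rewrite // eq_sym.
have f_inj : injective f.
  move=> i i' fii'; have /eqP/sum_nat_eq1[k [_ Mk Mk0]] := col (f i).
  have only (a : 'I_n) : M a (f i) = 1 -> a = k.
    by have [//|ak] := eqVneq a k; rewrite Mk0.
  by rewrite [i]only ?fP ?eqxx // [i']only // fP fii' eqxx.
by exists (perm f_inj) => i j; rewrite perm_matrixE permE fP.
Qed.

(** * Conjugate partitions and one-cell steps *)

Definition columns N (f : nat -> nat) (j : nat) : nat := \sum_(k < N) (j < f k).

Lemma count_initial (b : nat -> bool) N :
    (forall k, b k.+1 -> b k) -> (forall k, N <= k -> ~~ b k) ->
  forall k, (k < \sum_(k' < N) b k') = b k.
Proof.
move=> bS; elim: N => [|N IHN] bN k; first by rewrite big_ord0 (negPf (bN k _)).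
rewrite big_ord_recr /=; have [bNt|bNf] := boolP (b N); last first.
  rewrite addn0; apply: IHN => m.
  by rewrite leq_eqVlt => /orP[/eqP<-//|]; apply: bN.
have down d : b (N - d).
  elim: d => [|d IHd]; first by rewrite subn0.
  rewrite subnS; case: (N - d) IHd => // m; exact: bS.
have -> : \sum_(k' < N) b k' = N.
  rewrite -[RHS]muln1 -[N in RHS]card_ord -sum_nat_const.
  apply: eq_bigr => k' _.
  by rewrite -[nat_of_ord k'](subKn (ltnW (ltn_ord k'))) down.
rewrite addn1 ltnS; have [lkN|lNk] := leqP k N.
  by rewrite -[k](subKn lkN) down.
by rewrite (negPf (bN k _)).
Qed.

(** Both sides say that the cell in row [k] and column [j] is in the diagram. *)
Lemma ltn_columns N f :
    (forall k, f k.+1 <= f k) -> (forall k, N <= k -> f k = 0) ->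
  forall j k, (k < columns N f j) = (j < f k).
Proof.
move=> fS fN j; apply: count_initial => k; first by move: (fS k); lia.
by move=> /fN->.
Qed.

Lemma columns_antitone N f j : columns N f j.+1 <= columns N f j.
Proof. by apply: leq_sum => k _; case: (ltnP j.+1 (f k)) => // /ltnW->. Qed.

Lemma leq_columns N f g j :
  (forall k, f k <= g k) -> columns N f j <= columns N g j.
Proof.
move=> fg; apply: leq_sum => k _.
by have [/leq_trans/(_ (fg k))->|] := ltnP j (f k).
Qed.

Lemma columns_le N f j : columns N f j <= N.
Proof.
rewrite -[N in leqRHS]muln1 -[N in N * 1]card_ord -sum_nat_const.
by apply: leq_sum => k _; case: ltnP.
Qed.

Lemma columns_eq0 N M f j : (forall k, f k <= M) -> M <= j -> columns N f j = 0.
Proof. by move=> fM Mj; apply: big1 => k _; move: (fM k); lia. Qed.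

Lemma sum_ltn M m : m <= M -> \sum_(j < M) (j < m) = m.
Proof.
move=> mM; rewrite -[RHS]muln1 -[m in RHS]card_ord -sum_nat_const.
by rewrite (big_ord_widen M (fun=> 1) mM) [RHS]big_mkcond.
Qed.

Lemma columnsK N M f :
    (forall k, f k.+1 <= f k) -> (forall k, N <= k -> f k = 0) ->
    (forall k, f k <= M) ->
  columns M (columns N f) =1 f.
Proof.
move=> fS fN fM k; rewrite /columns.
under eq_bigr do rewrite [_ < _](ltn_columns fS fN).
exact: sum_ltn.
Qed.

Lemma sum_columns N M f : (forall k, f k <= M) ->
  \sum_(j < M) columns N f j = \sum_(k < N) f k.
Proof.
move=> fM; rewrite exchange_big /=; apply: eq_bigr => k _; exact: sum_ltn.
Qed.

Lemma sum_succ N (f g : nat -> nat) :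
    (forall k, f k <= g k) -> \sum_(k < N) g k = (\sum_(k < N) f k).+1 ->
  exists2 a : 'I_N, g a = (f a).+1 & forall k : 'I_N, k != a -> g k = f k.
Proof.
move=> fg sumS.
have : \sum_(k < N) (g k - f k) == 1.
  rewrite sumnB; first by rewrite sumS subSnn.
  by move=> k _; apply: fg.
move=> /sum_nat_eq1[a [_ ga gk]]; exists a; first by move: (fg a); lia.
by move=> k /gk => /(_ isT); move: (fg k); lia.
Qed.

(** Interlacing asks that the lengthened row not exceed the row above it; that
    row has the same length in [f] and [g], and [g] is a partition. *)
Lemma succ_interlace N (f g : nat -> nat) :
    (forall k, f k.+1 <= f k) -> (forall k, g k.+1 <= g k) ->
    (forall k, N <= k -> g k = 0) ->
    (forall k, f k <= g k) -> \sum_(k < N) g k = (\sum_(k < N) f k).+1 ->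
  interlace f g.
Proof.
move=> fS gS gN fg /(sum_succ fg)[a ga gk] k; rewrite fg /=.
have [lSN|/gN->//] := ltnP k.+1 N.
have [kSa|kSa] := eqVneq (Ordinal lSN) a; last by rewrite [g _](gk _ kSa) fS.
rewrite -[f k](gk (Ordinal (ltnW lSN))) ?gS // -kSa -val_eqE /=.
by rewrite neq_ltn ltnSn.
Qed.

(** * Walkers moving to the left *)

Section Walkers.
Variable p : nat.
Import GRing.Theory.

Definition walkers (d : nat -> nat) : positions p :=
  [ffun j : 'I_p => (j.+1%:Z - (d j)%:Z)%R].

Definition displacements (x : positions p) (j : nat) : nat :=
  if insub j is Some i then `|((i : 'I_p).+1%:Z - x i)%R|%N else 0.

Definition left_step (y z : positions p) := exists a : 'I_p,
  z a = (y a - 1)%R /\ forall k, k != a -> z k = y k.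

Definition shape (d : nat -> nat) :=
  (forall j, d j.+1 <= d j) /\ (forall j, p <= j -> d j = 0).

Lemma eq_walkers d d' : d =1 d' -> walkers d = walkers d'.
Proof. by move=> dd'; apply/ffunP => j; rewrite !ffunE dd'. Qed.

Lemma walkers0 : walkers (fun=> 0) = initial_positions p.
Proof. by apply/ffunP => j; rewrite !ffunE subr0. Qed.

Lemma walkersK d : shape d -> displacements (walkers d) =1 d.
Proof.
move=> [_ dp] j; rewrite /displacements; case: insubP => [i _ <-|].
  by rewrite ffunE opprB addrCA subrr addr0 absz_nat.
by rewrite -leqNgt => /dp.
Qed.

Lemma shape_leq d j k : shape d -> j <= k -> d k <= d j.
Proof.
move=> [dS _]; move/subnK<-; elim: (k - j) => //= m IHm.
exact: leq_trans (dS _) IHm.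
Qed.

Lemma walkers_inj d : shape d -> injective (walkers d).
Proof.
move=> dsh i j; rewrite !ffunE => E; apply: val_inj => /=.
by case: (ltngtP i j) => // ij;
  move: (shape_leq dsh (ltnW ij)) E; lia.
Qed.

Lemma left_step_walkers (d d' : nat -> nat) : (forall j, d j <= d' j) ->
  \sum_(j < p) d' j = (\sum_(j < p) d j).+1 ->
  left_step (walkers d) (walkers d').
Proof.
move=> dd' /(sum_succ dd')[a d'a d'k]; exists a; split=> [|k ka].
  by rewrite !ffunE d'a; lia.
by rewrite !ffunE d'k.
Qed.

(** The walkers stay ordered: after moving, walker [a] is at worst on the site
    of its left neighbour, which exclusion forbids.  So the displacements are
    again a partition. *)
Lemma left_step_shape (d : nat -> nat) (z : positions p) :
    shape d -> injective z -> left_step (walkers d) z ->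
  exists d', [/\ shape d', z = walkers d', forall j, d j <= d' j &
                 \sum_(j < p) d' j = (\sum_(j < p) d j).+1].
Proof.
move=> dsh z_inj [a [za zk]]; have [dS dp] := dsh.
pose d' j := d j + (j == a).
have zE : z = walkers d'.
  apply/ffunP => k; rewrite ffunE /d'; have [->|ka] := eqVneq k a.
    by rewrite eqxx za ffunE; lia.
  by rewrite (zk _ ka) ffunE val_eqE (negPf ka) addn0.
exists d'; split=> // [|j|]; [split=> j| |].
- rewrite /d'; have [jSa|] := eqVneq j.+1 a; last by move: (dS j); lia.
  have ja : (j == a) = false by lia.
  rewrite ja addn0 addn1 ltn_neqAle dS andbT; apply/eqP => dj.
  have jp : j < p by move: (ltn_ord a); lia.
  have /z_inj : z (Ordinal jp) = z a.
    rewrite zE !ffunE /d' /= ja eqxx -jSa dj; lia.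
  by move=> Ea; move: ja; rewrite -Ea eqxx.
- by move=> pj; rewrite /d' dp //; move: (ltn_ord a); lia.
- exact: leq_addr.
- rewrite /d' big_split /= -addn1; congr (_ + _).
  by rewrite (bigD1 a) //= eqxx big1 // => k /negPf; rewrite val_eqE => ->.
Qed.

(** Growth diagrams describe a partition by its rows, whereas the displacements
    are its column lengths. *)
Definition rows (x : positions p) := columns p (displacements x).

Lemma rows_walkers d : shape d -> rows (walkers d) =1 columns p d.
Proof. by move=> dsh k; apply: eq_bigr => j _; rewrite walkersK. Qed.

Lemma shape_leq_sum t d :
  shape d -> \sum_(j < p) d j = t -> forall j, d j <= t.
Proof.
move=> [_ dp] <- j; have [jp|/dp->//] := ltnP j p.
by rewrite (bigD1 (Ordinal jp)) //= leq_addr.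
Qed.

Section LeftPath.
Variables (n : nat) (w : nat -> positions p).
Hypothesis w0 : w 0 = initial_positions p.
Hypothesis w_inj : forall t, t <= n -> injective (w t).
Hypothesis w_left : forall t, t < n -> left_step (w t) (w t.+1).

Lemma left_path_shape t : t <= n -> exists d,
  [/\ shape d, w t = walkers d & \sum_(j < p) d j = t].
Proof.
elim: t => [_|t IHt ltn].
  by exists (fun=> 0); split; rewrite // ?w0 ?walkers0 // big1.
have [d [dsh wE sumd]] := IHt (ltnW ltn).
have := w_left ltn; rewrite wE => /(left_step_shape dsh (w_inj ltn)).
by move=> [d' [d'sh w'E _ sumd']]; exists d'; rewrite sumd' sumd.
Qed.

Lemma rowsK t : t <= n -> walkers (columns n (rows (w t))) = w t.
Proof.
move=> ltn; have [d [dsh -> sumd]] := left_path_shape ltn.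
apply: eq_walkers => j; rewrite -[RHS](columnsK (N := p) (M := n)).
- by apply: eq_bigr => k _; rewrite rows_walkers.
- exact: dsh.1.
- exact: dsh.2.
- by move=> k; apply: leq_trans (shape_leq_sum dsh sumd k) ltn.
Qed.

Lemma rows0 : rows (w 0) =1 fun=> 0.
Proof.
move=> k; rewrite w0 -walkers0 rows_walkers; last by split.
exact: big1.
Qed.

Lemma rows_step t : t < n -> interlace (rows (w t)) (rows (w t.+1)) /\
  \sum_(k < n) rows (w t.+1) k = (\sum_(k < n) rows (w t) k).+1.
Proof.
move=> ltn; have [d [dsh wE sumd]] := left_path_shape (ltnW ltn).
have := w_left ltn; rewrite wE => /(left_step_shape dsh (w_inj ltn)).
move=> [d' [d'sh -> dd' sumdd']].
have d'n j : d' j <= n.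
  by apply: leq_trans ltn; rewrite -sumd -sumdd' shape_leq_sum.
have dn j : d j <= n by apply: leq_trans (dd' j) (d'n j).
have E : \sum_(k < n) rows (walkers d') k =
         (\sum_(k < n) rows (walkers d) k).+1.
  under eq_bigr do rewrite rows_walkers //.
  under [in RHS]eq_bigr do rewrite rows_walkers //.
  by rewrite !sum_columns.
split=> //; apply: (succ_interlace (N := n)) E => k.
- exact: columns_antitone.
- exact: columns_antitone.
- by move=> nk; rewrite rows_walkers //; apply: columns_eq0 nk.
- by rewrite !rows_walkers //; apply: leq_columns.
Qed.

End LeftPath.

(** * Configurations as pairs of chains *)

Section History.
Variable n : nat.
Implicit Type x : history p (n + n).

Lemma tnth_LnRn (t : 'I_(n + n)) : tnth (LnRn n) t = if t < n then L else R.
Proof.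
rewrite (tnth_nth L) /= nth_cat size_nseq !nth_nseq.
by case: (ltnP t n) => // nt; rewrite ltn_subLR // ltn_ord.
Qed.

(** A step to the right is a step to the left with time reversed. *)
Lemma is_move_follows (y z : positions p) (a : letter) :
  (is_move y z /\
   forall j : 'I_p, z j != y j -> z j = (y j + displacement a)%R) <->
  if a is L then left_step y z else left_step z y.
Proof.
split=> [[[j [zj zk]] dir]|].
  have neq : z j != y j by apply/eqP; lia.
  have := dir j neq; case: a {dir} => /= zyj; exists j; split=> // [|k kj].
  - by rewrite zyj; lia.
  - by rewrite zk.
case: a => -[j [zj zk]];
  (split; first (exists j; split=> [|k kj]; [lia|by rewrite zk])).
  by move=> k; have [->|/zk->] := eqVneq k j; rewrite ?eqxx // zj.
by move=> k; have [->|/zk->] := eqVneq k j; rewrite ?eqxx // zj /=; lia.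
Qed.

(** Both halves become chains of left steps from the initial positions, the
    second one being read backwards from time [n + n]. *)
Lemma configurations_LnRnP x : configurations_following p (LnRn n) x <->
  [/\ x ord0 = initial_positions p, x ord_max = initial_positions p,
      forall t, injective (x t) &
      forall t, t < n -> left_step (x (inord t)) (x (inord t.+1)) /\
                left_step (x (inord (n + n - t))) (x (inord (n + n - t.+1)))].
Proof.
have at_time (t : 'I_(n + n)) :
    before x t = x (inord t) /\ after x t = x (inord t.+1).
  by split; congr (x _); apply: val_inj;
    rewrite /= inordK //; move: (ltn_ord t); lia.
have step_iff : (forall u, is_move (before x u) (after x u)) /\
      follows x (LnRn n) <->
    forall u : 'I_(n + n),
      if u < n then left_step (x (inord u)) (x (inord u.+1))
      else left_step (x (inord u.+1)) (x (inord u)).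
  split=> [[x_move x_dir] u|steps].
    have [<- <-] := at_time u.
    have := (is_move_follows _ _ (tnth (LnRn n) u)).1
      (conj (x_move u) (x_dir u)).
    by rewrite tnth_LnRn; case: (u < n) => step_u; exact: step_u.
  suff both u : is_move (before x u) (after x u) /\ forall j : 'I_p,
      after x u j != before x u j ->
      after x u j = (before x u j + displacement (tnth (LnRn n) u))%R.
    split=> [u|u j]; have [move_u dir_u] := both u; first exact: move_u.
    exact: dir_u.
  apply/is_move_follows; have [-> ->] := at_time u.
  by have := steps u; rewrite tnth_LnRn; case: (u < n) => step_u; exact: step_u.
split=> [[[x0 xn x_inj x_move] x_dir]|[x0 xn x_inj steps]].
  split=> // t ltn; have {}step := step_iff.1 (conj x_move x_dir).
  have tnn : t < n + n by lia.
  have tnn' : n + n - t.+1 < n + n by lia.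
  split; first by have := step (Ordinal tnn); rewrite ltn.
  have := step (Ordinal tnn'); rewrite ifF /=; last by lia.
  by rewrite (_ : (n + n - t.+1).+1 = n + n - t) //; lia.
suff [x_move x_dir] : (forall u, is_move (before x u) (after x u)) /\
    follows x (LnRn n) by [].
apply/step_iff => u; have [un|nu] := ltnP u n; first by have [] := steps u un.
have utn := ltn_ord u.
have tn : n + n - u.+1 < n by lia.
have [_] := steps _ tn.
by rewrite subKn // (_ : n + n - (n + n - u.+1).+1 = u) //; lia.
Qed.

End History.
End Walkers.

(** * The bijection *)

Section Bijection.
Variables p n : nat.

(** The two far sides of the growth diagram, followed from the corner (n, 0) to
    the corner (0, n). *)
Definition boundary (s : 'S_n) t : nat -> nat :=
  if t <= n then grow (perm_matrix s) n t
  else grow (perm_matrix s) (n + n - t) n.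

Definition perm_history (s : 'S_n) : history p (n + n) :=
  [ffun t : 'I_(n + n).+1 => walkers p (columns n (boundary s t))].

Lemma shape_columns f : (forall k, f k <= p) -> shape p (columns n f).
Proof.
by move=> fp; split=> j; [apply: columns_antitone | apply: columns_eq0].
Qed.

(** Conjugation preserves inclusion and size, so one more cell in the rows is
    one more cell in the columns. *)
Lemma left_step_columns (f g : nat -> nat) :
    (forall k, f k <= g k) -> (forall k, g k <= p) ->
    \sum_(k < n) g k = \sum_(k < n) f k + 1 ->
  left_step (walkers p (columns n f)) (walkers p (columns n g)).
Proof.
move=> fg gp sumS; apply: left_step_walkers => [j|]; first exact: leq_columns.
rewrite !sum_columns ?sumS ?addn1 // => k.
exact: leq_trans (fg k) (gp k).
Qed.

Section ToHistory.
Variable s : 'S_n.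

Lemma perm_historyE t : t <= n + n ->
  perm_history s (inord t) = walkers p (columns n (boundary s t)).
Proof. by move=> tnn; rewrite ffunE inordK. Qed.

Lemma boundary_bottom t : t <= n -> boundary s t = grow (perm_matrix s) n t.
Proof. by rewrite /boundary => ->. Qed.

Lemma boundary_right t : t <= n ->
  boundary s (n + n - t) = grow (perm_matrix s) t n.
Proof.
rewrite /boundary leq_eqVlt => /orP[/eqP->|tn]; first by rewrite addnK leqnn.
by rewrite ifF ?subKn //; lia.
Qed.

Hypothesis lis_s : max_increasing_length s <= p.

Lemma grow_box i j : i <= n -> j <= n ->
  (forall k, grow (perm_matrix s) i j k <= p) /\
  (forall k, n <= k -> grow (perm_matrix s) i j k = 0).
Proof.
move=> lin ljn; split=> k; last first.
  by move=> nk; apply: grow_support; apply: leq_trans lin nk.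
apply: leq_trans lis_s; rewrite max_increasing_length_grow.
by apply: leq_trans (grow_leq_row0 _ _ _ _) _; apply: grow_leq.
Qed.

Lemma boundary_box t : t <= n + n ->
  (forall k, boundary s t k <= p) /\ (forall k, n <= k -> boundary s t k = 0).
Proof.
by move=> tnn; rewrite /boundary; case: leqP => tn; apply: grow_box; lia.
Qed.

Lemma perm_history_configuration :
  configurations_following p (LnRn n) (perm_history s).
Proof.
apply/configurations_LnRnP; split.
- rewrite ffunE -walkers0; apply: eq_walkers => j.
  by apply: big1 => k _; rewrite /boundary /= growi0.
- have := boundary_right (leq0n n); rewrite subn0 ffunE -walkers0 => E.
  by apply: eq_walkers => j; apply: big1 => k _; rewrite /= E.
- move=> t; rewrite ffunE; apply: walkers_inj; apply: shape_columns.
  by have [] := @boundary_box t (ltn_ord t).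
move=> t tn; rewrite !perm_historyE; try lia.
have tn' := ltnW tn.
rewrite (boundary_bottom tn') (boundary_bottom tn).
rewrite (boundary_right tn') (boundary_right tn).
split; apply: left_step_columns => [k|k|].
- by apply: grow_leq.
- by have [] := @grow_box n t.+1 (leqnn n) tn.
- by rewrite grow_col_sum // (perm_matrix_col_sum s (Ordinal tn)).
- by apply: grow_leq.
- by have [] := @grow_box t.+1 n tn (leqnn n).
- by rewrite grow_row_sum // (perm_matrix_row_sum s (Ordinal tn)).
Qed.

End ToHistory.

Lemma boundary_antitone s t k : boundary s t k.+1 <= boundary s t k.
Proof. by rewrite /boundary; case: ifP => _; apply: grow_antitone. Qed.

Lemma perm_history_inj s s' :
    max_increasing_length s <= p -> max_increasing_length s' <= p ->
  perm_history s = perm_history s' -> s = s'.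
Proof.
move=> lis_s lis_s' hist.
have bd t : t <= n + n -> boundary s t =1 boundary s' t.
  move=> tnn k; have [sp sn] := boundary_box lis_s tnn.
  have [sp' sn'] := boundary_box lis_s' tnn.
  rewrite -(columnsK (boundary_antitone s t) sn sp).
  rewrite -(columnsK (boundary_antitone s' t) sn' sp').
  apply: eq_bigr => j _; congr (nat_of_bool (_ < _)).
  rewrite -(walkersK (shape_columns sp)) -(walkersK (shape_columns sp')).
  by rewrite -!perm_historyE // hist.
have /grow_inj eqM : forall t, t <= n ->
    grow (perm_matrix s) n t =1 grow (perm_matrix s') n t.
  by move=> t tn; rewrite -!boundary_bottom //; apply: bd; lia.
apply/permP => a; apply/eqP.
have := eqM _ a (s' a); rewrite !perm_matrixE eqxx.
have eqR t : t <= n -> grow (perm_matrix s) t n =1 grow (perm_matrix s') t n.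
  by move=> tn; rewrite -!boundary_right //; apply: bd; lia.
by move=> /(_ eqR (ltn_ord _) (ltn_ord _)); case: eqP.
Qed.

Lemma perm_history_surj x : configurations_following p (LnRn n) x ->
  exists2 s, max_increasing_length s <= p & perm_history s = x.
Proof.
move=> /configurations_LnRnP[x0 xn x_inj steps].
pose bot t := x (inord t); pose right t := x (inord (n + n - t)).
have bot0 : bot 0 = initial_positions p.
  by rewrite -x0; congr (x _); apply: val_inj; rewrite /= inordK.
have right0 : right 0 = initial_positions p.
  by rewrite -xn; congr (x _); apply: val_inj; rewrite /= subn0 inordK.
have bot_inj t : t <= n -> injective (bot t) by move=> _; exact: x_inj.
have right_inj t : t <= n -> injective (right t) by move=> _; exact: x_inj.
have bot_left t : t < n -> left_step (bot t) (bot t.+1) by move=> /steps[].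
have right_left t : t < n -> left_step (right t) (right t.+1).
  by move=> /steps[].
pose P t := rows (bot t); pose Q t := rows (right t).
have PQ : P n = Q n by rewrite /P /Q /right addnK.
have P0 := rows0 bot0; have Q0 := rows0 right0.
have Pstep := rows_step bot0 bot_inj bot_left.
have Qstep := rows_step right0 right_inj right_left.
have [M [MP MQ]] := grow_surj P0 Q0 PQ (fun j jn => (Pstep j jn).1)
  (fun i i_n => (Qstep i i_n).1).
have row_sum (i : 'I_n) : \sum_(j < n) M i j = 1.
  have := grow_row_sum M (ltn_ord i).
  under eq_bigr do rewrite MQ //.
  under [in RHS]eq_bigr do rewrite MQ ?(ltnW (ltn_ord i)) //.
  by rewrite (Qstep i (ltn_ord i)).2 -addn1 => /addnI.
have col_sum (j : 'I_n) : \sum_(i < n) M i j = 1.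
  have := grow_col_sum M (ltn_ord j).
  under eq_bigr do rewrite MP //.
  under [in RHS]eq_bigr do rewrite MP ?(ltnW (ltn_ord j)) //.
  by rewrite (Pstep j (ltn_ord j)).2 -addn1 => /addnI.
(* Each chain grows by one cell at a time, so all line sums of [M] are 1. *)
have [s sM] := perm_matrix_surj row_sum col_sum.
have growM i j : i <= n -> j <= n -> grow M i j =1 grow (perm_matrix s) i j.
  apply: grow_unique => [j' _ //|i' _|i' j' lin ljn]; first exact: growi0.
  by rewrite -(sM (Ordinal lin) (Ordinal ljn)); apply: growP.
exists s.
  by rewrite max_increasing_length_grow -growM // MP //; apply: columns_le.
apply/ffunP => t; rewrite ffunE.
have tnn : t <= n + n := ltn_ord t.
have [tn|nt] := leqP t n.
  rewrite boundary_bottom // -[RHS](_ : bot t = x t); last first.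
    by congr (x _); apply: val_inj; rewrite /= inordK.
  rewrite -(rowsK bot0 bot_inj bot_left tn); apply: eq_walkers => j.
  by apply: eq_bigr => k _; rewrite -growM // MP.
have t'n : n + n - t <= n by lia.
rewrite -[RHS](_ : right (n + n - t) = x t); last first.
  by congr (x _); apply: val_inj; rewrite /= inordK subKn.
rewrite -(rowsK right0 right_inj right_left t'n); apply: eq_walkers => j.
rewrite -[in LHS](subKn tnn) boundary_right //.
by apply: eq_bigr => k _; rewrite -growM // MQ.
Qed.

End Bijection.

Lemma card_II_finset (T : finType) (A : {set T}) :
  ([set a | a \in A]%classic #= `I_#|A|)%card.
Proof.
have -> : [set a | a \in A]%classic = ((@enum_val T (mem A)) @` setT)%classic.
  apply/seteqP; split=> [a aA|_ [i _ <-]]; last exact: enum_valP.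
  by exists (enum_rank_in aA a) => //; rewrite enum_rankK_in.
rewrite (card_eqr card_II); apply: inj_card_eq => i j _ _; exact: enum_val_inj.
Qed.

Theorem proposition1 (p n : nat) (hp : (1 <= p)%N) (hn : (1 <= n)%N) :
  (configurations_following p (LnRn n)
     #= `I_(#|[set s : 'S_n | (max_increasing_length s <= p)%N]%SET|))%card.
Proof.
set A := [set s : 'S_n | _]%SET.
have AE s : (s \in A) = (max_increasing_length s <= p) by rewrite inE.
have -> : configurations_following p (LnRn n) =
    (@perm_history p n @` [set s | s \in A])%classic.
  apply/seteqP; split=> [x /perm_history_surj[s lis_s <-]|_ [s sA <-]].
    by exists s; rewrite /= ?AE.
  by apply: perm_history_configuration; rewrite -AE.
apply: card_eq_trans (card_II_finset A); apply: inj_card_eq.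
move=> s s'; rewrite !mem_setE /= !inE => lis_s lis_s'.
exact: perm_history_inj.
Qed.
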